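(* For every $a \in \left(\frac{3}{2},2\right)$ and every $x \in (0,m_a)$, where $m_a = \sqrt{2\pi^2\left(a-\frac{3}{2}\right)}$, the following double-sided inequality holds: $$\left(\frac{\sin x}{x}\right)^{a} \;<\; \left(\frac{\sin x}{x}\right)^{\frac{3}{2}+\frac{x^2}{2\pi^2}} \;<\; \cos^{2}\frac{x}{2}.$$ *)

(* Defs.v *)
From Stdlib Require Export Reals.

Open Scope R_scope.

(* [Rpower b y] is [exp (y * ln b)], the usual real power only for [0 < b].
   It is applied to [b = sin x / x] with [0 < x < m a < PI], so [b] is positive. *)
Definition m (a : R) : R := sqrt (2 * PI ^ 2 * (a - 3 / 2)).

(* Main.v *)
(** Put [y = x / 2] and [t = x^2 / PI^2], so that [sin x / x = cos y * (sin y / y)].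
    With [B = ln (y / sin y)], the second inequality becomes
    [(3 + t) / (1 - t) * B + ln (cos y) > 0].  The left side tends to [0] at [0]; since
    [B >= y^2 / 6] and [1 / y - cot y >= y / 3], its derivative is at least
    [y * (1 + 2 t / 3 - t^2 / 3) / (1 - t)^2 - tan y], which is positive on [(0, PI / 2)]
    because [sin y < y] and [cos y] exceeds [(1 - t)^2 / (1 + 2 t / 3 - t^2 / 3)]. *)

Require Import Defs.
From Stdlib Require Import Reals Lra.
From Coquelicot Require Import Coquelicot.
Open Scope R_scope.

Lemma pos_derive_increasing (f df : R -> R) (u v : R) :
  u < v -> (forall z, u <= z <= v -> is_derive f z (df z)) ->
  (forall z, u <= z <= v -> 0 < df z) -> f u < f v.
Proof.
intros Huv Hf Hpos.
destruct (MVT_gen f u v df) as [c [Hc Heq]].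
- intros z Hz. apply Hf. rewrite Rmin_left, Rmax_right in Hz; lra.
- intros z Hz. rewrite Rmin_left, Rmax_right in Hz by lra.
  apply derivable_continuous_pt. exists (df z). apply is_derive_Reals, Hf; lra.
- rewrite Rmin_left, Rmax_right in Hc by lra.
  pose proof (Hpos c Hc). nra.
Qed.

(* The minorant [g] replaces a limit of [f] at [0], where [f] may take a junk value. *)
Lemma pos_derive_pos (f df g : R -> R) (b : R) :
  (forall z, 0 < z < b -> is_derive f z (df z)) ->
  (forall z, 0 < z < b -> 0 < df z) ->
  (forall z, 0 < z < b -> g z <= f z) ->
  continuity_pt g 0 -> g 0 = 0 ->
  forall y, 0 < y < b -> 0 < f y.
Proof.
intros Hf Hpos Hg Hc Hg0 y Hy.
assert (H1 : f (y / 2) < f y).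
{ apply (pos_derive_increasing f df); try lra; intros z Hz;
    [apply Hf | apply Hpos]; lra. }
(* Were [f (y / 2)] negative, monotonicity would keep [f], hence [g], below that value at every
   point of [(0, y / 2)], against [g] tending to [0]. Strict positivity at [y] then comes from
   [H1]. *)
destruct (Rlt_or_le (f (y / 2)) 0) as [Hneg | ]; [ | lra].
destruct (Hc (- f (y / 2))) as [d [Hd Hlim]]; [lra | ].
pose (e := Rmin (d / 2) (y / 4)).
assert (He : 0 < e) by (apply Rmin_glb_lt; lra).
assert (He1 : e <= d / 2) by apply Rmin_l.
assert (He2 : e <= y / 4) by apply Rmin_r.
assert (H2 : f e < f (y / 2)).
{ apply (pos_derive_increasing f df); try lra; intros z Hz;
    [apply Hf | apply Hpos]; lra. }
assert (H3 : R_dist (g e) (g 0) < - f (y / 2)).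
{ apply Hlim. split; [split; [exact I | lra] | ].
  simpl. unfold R_dist. rewrite Rabs_pos_eq; lra. }
rewrite Hg0 in H3. unfold R_dist in H3. apply Rabs_def2 in H3.
specialize (Hg e). lra.
Qed.

Lemma cos_lt_sinc (y : R) : 0 < y < PI -> 0 < sin y - y * cos y.
Proof.
apply (pos_derive_pos (fun y => sin y - y * cos y) (fun y => y * sin y)
         (fun y => - y)).
- intros z Hz. auto_derive; [easy | ring].
- intros z Hz. apply Rmult_lt_0_compat; [ | apply sin_gt_0]; lra.
- intros z Hz. pose proof (sin_gt_0 z ltac:(lra) ltac:(lra)). pose proof (COS_bound z). nra.
- apply derivable_continuous_pt. reg.
- ring.
Qed.

(** This is [1 / y - cot y > y / 3] multiplied by [y * sin y]; in this form the derivative is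
    [y / 3] times the quantity of [cos_lt_sinc]. *)
Lemma cot_bound (y : R) : 0 < y < PI -> 0 < sin y - y * cos y - y ^ 2 / 3 * sin y.
Proof.
apply (pos_derive_pos (fun y => sin y - y * cos y - y ^ 2 / 3 * sin y)
         (fun y => y / 3 * (sin y - y * cos y)) (fun y => - (y ^ 2 / 3 * sin y))).
- intros z Hz. auto_derive; [easy | field].
- intros z Hz. apply Rmult_lt_0_compat; [lra | apply cos_lt_sinc, Hz].
- intros z Hz. pose proof (cos_lt_sinc z Hz). lra.
- apply derivable_continuous_pt. reg.
- rewrite sin_0. ring.
Qed.

Lemma ln_sinc_bound (y : R) : 0 < y < PI -> 0 < ln y - ln (sin y) - y ^ 2 / 6.
Proof.
apply (pos_derive_pos (fun y => ln y - ln (sin y) - y ^ 2 / 6)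
         (fun y => / y - cos y / sin y - y / 3) (fun y => - (y ^ 2 / 6))).
- intros z Hz. pose proof (sin_gt_0 z ltac:(lra) ltac:(lra)).
  auto_derive; [lra | field; lra].
- intros z Hz. pose proof (sin_gt_0 z ltac:(lra) ltac:(lra)).
  replace (/ z - cos z / sin z - z / 3)
    with ((sin z - z * cos z - z ^ 2 / 3 * sin z) / (z * sin z)) by (field; lra).
  apply Rdiv_lt_0_compat; [apply cot_bound, Hz | nra].
- intros z Hz. pose proof (sin_gt_0 z ltac:(lra) ltac:(lra)).
  pose proof (sin_lt_x z ltac:(lra)).
  pose proof (ln_increasing (sin z) z). lra.
- apply derivable_continuous_pt. reg.
- field.
Qed.

(** With [s = 2 * y / PI], so that [t = s ^ 2], a polynomial minorant of [cos y] leaves an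
    inequality in [s] alone: a parabola serves up to [s = 1 / 2], the chord [1 - s] beyond. *)
Lemma cos_minorant (y : R) (t := 4 * y ^ 2 / PI ^ 2) : 0 < y < PI / 2 ->
  (1 - t) ^ 2 < cos y * (1 + 2 * t / 3 - t ^ 2 / 3).
Proof.
intros Hy.
pose proof PI_RGT_0. pose proof PI_4. pose proof PI2_3_2.
pose (s := 2 * y / PI).
assert (Hys : y = PI / 2 * s) by (unfold s; field; lra).
assert (Ht : t = s ^ 2) by (unfold t, s; field; lra).
assert (Hs : 0 < s < 1).
{ split; apply (Rmult_lt_reg_l (PI / 2)); lra. }
clearbody t s. rewrite Ht.
assert (Hpos : 0 <= 1 + 2 * s ^ 2 / 3 - (s ^ 2) ^ 2 / 3).
{ assert (0 <= s ^ 2 <= 1) by nra. nra. }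
destruct (Rle_or_lt s (1 / 2)) as [Hs2 | Hs2].
(* From [cos y >= 1 - y ^ 2 / 2] and [PI <= 4]. *)
- assert (Hcos : 1 - 2 * s ^ 2 <= cos y).
  { assert (Hy2 : 0 < y <= 2 * s) by nra.
    destruct (pre_cos_bound y 0) as [Hc _]; [lra | lra | ].
    unfold cos_approx, cos_term in Hc. simpl in Hc. nra. }
  apply Rlt_le_trans with ((1 - 2 * s ^ 2) * (1 + 2 * s ^ 2 / 3 - (s ^ 2) ^ 2 / 3)).
  + assert (Hw : 0 < s ^ 2 <= 1 / 4) by nra.
    assert (0 < (s ^ 2) ^ 3) by (apply pow_lt; lra).
    (* The exact difference of the two sides; [s <= 1 / 2] makes its first term nonnegative. *)
    enough (0 < 2 / 3 * (s ^ 2 * (1 - 4 * s ^ 2) + (s ^ 2) ^ 3)) by lra.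
    nra.
  + apply Rmult_le_compat_r; lra.
- assert (Hcos : 1 - s <= cos y).
  { rewrite <- sin_shift.
    pose (z := PI / 2 - y). fold z.
    (* For [z <= 1], [sin z >= z - z ^ 3 / 6 >= 5 / 6 * z], and [5 / 6 * (3 / 2) > 1]. *)
    assert (Hz : 0 < z <= 1 /\ 3 / 2 * (1 - s) <= z) by (unfold z; nra).
    destruct (pre_sin_bound z 0) as [Hc _]; [lra | lra | ].
    unfold sin_approx, sin_term in Hc. simpl in Hc. nra. }
  apply Rlt_le_trans with ((1 - s) * (1 + 2 * s ^ 2 / 3 - (s ^ 2) ^ 2 / 3)).
  + assert (0 < (1 - s) * s * (5 * s / 3 + s ^ 2 - s ^ 3 / 3 - 1)).
    { apply Rmult_lt_0_compat; nra. }
    nra.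
  + apply Rmult_le_compat_r; lra.
Qed.

(** Dividing by [1 - t] gives [ln (cos y)] a constant coefficient, so it differentiates to [- tan y]
    and only the logarithms bounded by [ln_sinc_bound] remain. *)
Lemma ln_cos_vs_ln_sinc (y : R) (t := 4 * y ^ 2 / PI ^ 2) : 0 < y < PI / 2 ->
  0 < (3 + t) / (1 - t) * (ln y - ln (sin y)) + ln (cos y).
Proof.
unfold t. pose proof PI_RGT_0.
assert (Ht : forall z, 0 < z < PI / 2 -> 0 < 4 * z ^ 2 / PI ^ 2 < 1).
{ intros z Hz. split.
  - apply Rdiv_lt_0_compat; nra.
  - apply Rlt_div_l; nra. }
apply (pos_derive_pos
         (fun y => (3 + 4 * y ^ 2 / PI ^ 2) / (1 - 4 * y ^ 2 / PI ^ 2)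
                     * (ln y - ln (sin y)) + ln (cos y))
         (fun y => 32 * y / PI ^ 2 / (1 - 4 * y ^ 2 / PI ^ 2) ^ 2
                     * (ln y - ln (sin y))
                   + (3 + 4 * y ^ 2 / PI ^ 2) / (1 - 4 * y ^ 2 / PI ^ 2)
                     * (/ y - cos y / sin y) - sin y / cos y)
         (fun y => ln (cos y))).
- intros z Hz. specialize (Ht z Hz).
  assert (0 < sin z) by (apply sin_gt_0; lra).
  assert (0 < cos z) by (apply cos_gt_0; lra).
  assert (PI * PI - 4 * (z * z) <> 0) by nra.
  auto_derive.
  + repeat split; try lra. simpl in Ht. unfold Rdiv in Ht. lra.
  + field. repeat split; try lra; simpl; nra.
- intros z Hz. pose proof (cos_minorant z Hz) as Hm. cbv zeta in Hm.
  specialize (Ht z Hz).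
  assert (Hsin : 0 < sin z) by (apply sin_gt_0; lra).
  assert (Hcos : 0 < cos z) by (apply cos_gt_0; lra).
  pose proof (ln_sinc_bound z ltac:(lra)) as HB.
  pose proof (cot_bound z ltac:(lra)) as HC.
  pose proof (sin_lt_x z ltac:(lra)) as Hsx.
  assert (HC' : z / 3 < / z - cos z / sin z).
  { replace (/ z - cos z / sin z) with ((sin z - z * cos z) / (z * sin z))
      by (field; lra).
    apply (Rlt_div_r (z / 3)); [apply Rmult_lt_0_compat | ]; lra. }
  (* This removes [PI], so that [t0] can be treated as a free variable in [(0, 1)]. *)
  replace (32 * z / PI ^ 2) with (8 / z * (4 * z ^ 2 / PI ^ 2)) by (field; lra).
  set (t0 := 4 * z ^ 2 / PI ^ 2) in *.
  clearbody t0.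
  apply Rlt_trans with
    (8 / z * t0 / (1 - t0) ^ 2 * (z ^ 2 / 6) + (3 + t0) / (1 - t0) * (z / 3)
       - sin z / cos z).
  + replace (8 / z * t0 / (1 - t0) ^ 2 * (z ^ 2 / 6) + (3 + t0) / (1 - t0) * (z / 3)
       - sin z / cos z)
      with ((z * (cos z * (1 + 2 * t0 / 3 - t0 ^ 2 / 3)) - sin z * (1 - t0) ^ 2)
              / ((1 - t0) ^ 2 * cos z)) by (field; lra).
    apply Rdiv_lt_0_compat; [ | apply Rmult_lt_0_compat; nra].
    assert (0 < (1 - t0) ^ 2) by nra.
    nra.
  + assert (0 < 8 / z * t0 / (1 - t0) ^ 2).
    { apply Rdiv_lt_0_compat; [ | nra].
      apply Rmult_lt_0_compat; [apply Rdiv_lt_0_compat | ]; lra. }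
    assert (0 < (3 + t0) / (1 - t0)) by (apply Rdiv_lt_0_compat; lra).
    apply Rplus_lt_compat_r, Rplus_lt_compat; apply Rmult_lt_compat_l; lra.
- intros z Hz. specialize (Ht z Hz).
  assert (0 < (3 + 4 * z ^ 2 / PI ^ 2) / (1 - 4 * z ^ 2 / PI ^ 2))
    by (apply Rdiv_lt_0_compat; lra).
  pose proof (ln_sinc_bound z ltac:(lra)).
  pose proof (pow2_ge_0 z). nra.
- apply derivable_continuous_pt. exists (- sin 0 / cos 0). apply is_derive_Reals.
  auto_derive; rewrite cos_0; [lra | field].
- rewrite cos_0. apply ln_1.
Qed.

Theorem theorem10 (a : R) (ha : 3 / 2 < a < 2) (x : R) (hx : 0 < x < m a) :
  Rpower (sin x / x) a < Rpower (sin x / x) (3 / 2 + x ^ 2 / (2 * PI ^ 2))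
    < (cos (x / 2)) ^ 2.
Proof.
pose proof PI_RGT_0.
assert (Hx2 : x ^ 2 < 2 * PI ^ 2 * (a - 3 / 2)).
{ assert (H0 : 0 <= 2 * PI ^ 2 * (a - 3 / 2)) by nra.
  pose proof (sqrt_sqrt _ H0). unfold m in hx. nra. }
(* Since [a < 2], [Hx2] gives [x ^ 2 < PI ^ 2]. *)
assert (Hpi : x < PI) by nra.
assert (Hexp : 3 / 2 + x ^ 2 / (2 * PI ^ 2) < a).
{ enough (x ^ 2 / (2 * PI ^ 2) < a - 3 / 2) by lra. apply Rlt_div_l; nra. }
assert (Hsin : 0 < sin x) by (apply sin_gt_0; lra).
assert (Hln : ln (sin x / x) < 0).
{ rewrite <- ln_1. apply ln_increasing; [apply Rdiv_lt_0_compat; lra | ].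
  apply Rlt_div_l; [lra | ]. pose proof (sin_lt_x x). lra. }
split.
- apply exp_increasing. nra.
- pose (y := x / 2). assert (Hy : x = 2 * y) by (unfold y; field).
  fold y. clearbody y. subst x.
  assert (Hsy : 0 < sin y) by (apply sin_gt_0; lra).
  assert (Hcy : 0 < cos y) by (apply cos_gt_0; lra).
  pose proof (ln_cos_vs_ln_sinc y ltac:(lra)) as HA. cbv zeta in HA.
  unfold Rpower.
  replace (cos y ^ 2) with (exp (2 * ln (cos y)))
    by (rewrite <- (Rpower_pow 2) by lra; reflexivity).
  apply exp_increasing.
  replace (sin (2 * y) / (2 * y)) with (cos y * (sin y / y))
    by (rewrite sin_2a; field; lra).
  rewrite ln_mult, ln_div by (try apply Rdiv_lt_0_compat; lra).
  pose (t := 4 * y ^ 2 / PI ^ 2).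
  assert (Ht : 0 < t < 1).
  { unfold t. split; [apply Rdiv_lt_0_compat | apply Rlt_div_l]; nra. }
  replace ((2 * y) ^ 2 / (2 * PI ^ 2)) with (t / 2) by (unfold t; field; lra).
  fold t in HA.
  (* Clearing [1 - t] makes [HA] twice the difference of the two sides of the goal. *)
  apply Rmult_lt_compat_l with (r := 1 - t) in HA; [ | lra].
  replace ((1 - t) * ((3 + t) / (1 - t) * (ln y - ln (sin y)) + ln (cos y)))
    with ((3 + t) * (ln y - ln (sin y)) + (1 - t) * ln (cos y)) in HA by (field; lra).
  lra.
Qed.
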